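(* Let $\delta$ be a range map. The space $\mathbf{Cl}_\delta$ endowed with the coproduct $\Delta$ and the counit $c$ is a counital cograded coalgebra. Moreover, $\Delta$ is coassociative if and only if $\delta$ is valley-free.
   Context: $\mathbb{K}$ is a field of characteristic zero and $\mathbb{N}=\{0,1,2,\dots\}$. A range map is a map $\delta:\mathbb{N}\setminus\{0\}\to\mathbb{N}$. It has a valley if there are $1\leq i_1<i_2<i_3$ with $\delta(i_1)>\delta(i_2)<\delta(i_3)$, and is valley-free otherwise. A $\delta$-cliff of size $n$ is a word $u=u_1\cdots u_n$ of nonnegative integers with $u_i\leq\delta(i)$ for all $i$; $\mathsf{Cl}_\delta(n)$ is the set of them and $\mathsf{Cl}_\delta=\bigsqcup_{n\geq0}\mathsf{Cl}_\delta(n)$. $\epsilon$ is the empty word. $\mathbf{Cl}_\delta=\bigoplus_{n\geq0}\mathbf{Cl}_\delta(n)$ is the graded $\mathbb{K}$-vector space with basis $\{\mathsf{F}_u:u\in\mathsf{Cl}_\delta\}$, $\mathsf{F}_u$ being of degree the size of $u$. For a word $v\in\mathbb{N}^n$, $\mathrm{r}_\delta(v)\in\mathsf{Cl}_\delta(n)$ is defined by $\mathrm{r}_\delta(v)_i:=\min\{v_i,\delta(i)\}$. The coproduct $\Delta:\mathbf{Cl}_\delta\to\mathbf{Cl}_\delta\otimes\mathbf{Cl}_\delta$ is the linear map $$\Delta(\mathsf{F}_w):=\sum_{w=uv}\mathsf{F}_u\otimes\mathsf{F}_{\mathrm{r}_\delta(v)},$$ the sum being over all factorizations of the word $w$ as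 a concatenation of two (possibly empty) words $u$ and $v$. The linear map $c:\mathbf{Cl}_\delta\to\mathbb{K}$ is defined by $c(\mathsf{F}_\epsilon)=1$ and $c(\mathsf{F}_u)=0$ for $u\neq\epsilon$. Here a ''coalgebra'' is a vector space with a linear map $\Delta$ to its tensor square, not assumed coassociative; counital means $(c\otimes I)\Delta=I=(I\otimes c)\Delta$ (with the usual identifications, $I$ the identity), cograded means $\Delta(\mathbf{Cl}_\delta(n))\subseteq\bigoplus_{k=0}^n\mathbf{Cl}_\delta(k)\otimes\mathbf{Cl}_\delta(n-k)$, and coassociative means $(\Delta\otimes I)\Delta=(I\otimes\Delta)\Delta$. *)

(* Defs.v *)
From HB Require Import structures.
From mathcomp Require Import all_boot all_algebra.
From mathcomp Require Import boolp.
From mathcomp Require Import freeg.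

Set Implicit Arguments.
Unset Strict Implicit.
Unset Printing Implicit Defensive.

Import GRing.Theory.
Local Open Scope ring_scope.
Local Open Scope quotient_scope.

Section Span.
Variables (K : fieldType) (V : lmodType K).
Implicit Types (S : V -> Prop) (x y : V).

Definition span S x : Prop :=
  exists2 s : seq (K * V), (forall p, p \in s -> S p.2)
                         & x = \sum_(p <- s) p.1 *: p.2.

Lemma span_gen S x : S x -> span S x.
Proof.
move=> Sx; exists [:: (1, x)] => [p|]; first by rewrite inE => /eqP ->.
by rewrite big_seq1 scale1r.
Qed.

Lemma span0 S : span S 0.
Proof. by exists [::] => //; rewrite big_nil. Qed.

Lemma spanD S x y : span S x -> span S y -> span S (x + y).
Proof.
move=> [s sS ->] [t tS ->]; exists (s ++ t) => [p|]; last by rewrite big_cat.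
by rewrite mem_cat => /orP[/sS|/tS].
Qed.

Lemma spanZ S a x : span S x -> span S (a *: x).
Proof.
move=> [s sS ->]; exists [seq (a * p.1, p.2) | p <- s] => [p|].
  by case/mapP => q /sS ? ->.
by rewrite big_map scaler_sumr; apply: eq_bigr => p _; rewrite scalerA.
Qed.

Lemma spanB S x y : span S x -> span S y -> span S (x - y).
Proof. by move=> Sx Sy; rewrite -scaleN1r; apply/spanD/spanZ. Qed.

End Span.

Section FreeLift.
Variables (K : fieldType) (B : choiceType) (V : lmodType K) (f : B -> V).

Lemma fglift_linear : linear (fglift f : {freeg B / K} -> V).
Proof.
have E D : fglift f D = \sum_(b <- dom D) coeff b D *: f b.
  by rewrite -[in LHS](Freeg_dom D) fglift_Freeg /prelift big_map.
have addf := @lift_is_additive _ _ _ f.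
have f0 : fglift f 0 = 0 by rewrite -(subrr 0) addf subrr.
have fN x : fglift f (- x) = - fglift f x by rewrite -sub0r addf f0 sub0r.
have fD x y : fglift f (x + y) = fglift f x + fglift f y.
  by rewrite -{1}[y]opprK addf fN opprK.
move=> a x y; rewrite fD; congr (_ + _).
rewrite -[a *: x]/(fgscale a x) /fgscale (big_morph _ fD f0) E scaler_sumr.
by apply: eq_bigr => b _; rewrite liftU scalerA.
Qed.

HB.instance Definition _ :=
  GRing.isLinear.Build K {freeg B / K} V _ (fglift f) fglift_linear.

End FreeLift.

(* V (x) W is the quotient of the free space on V * W by the bilinearity      *)
(* relations.                                                                 *)
Section Tensor.
Variables (K : fieldType) (V W : lmodType K).

Inductive bilinear_relation : {freeg (V * W) / K} -> Prop :=
| RelL a x y z :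
    bilinear_relation (<< (a *: x + y, z) >> - a *: << (x, z) >> - << (y, z) >>)
| RelR a x y z :
    bilinear_relation (<< (x, a *: y + z) >> - a *: << (x, y) >> - << (x, z) >>).

Definition tensor_ker : {pred {freeg (V * W) / K}} :=
  fun d => `[< span bilinear_relation d >].

Lemma tensor_kerP d : reflect (span bilinear_relation d) (d \in tensor_ker).
Proof. exact: asboolP. Qed.

Lemma tensor_ker_zmod : zmod_closed tensor_ker.
Proof.
split=> [|d e /tensor_kerP Rd /tensor_kerP Re]; first exact/tensor_kerP/span0.
exact/tensor_kerP/spanB.
Qed.
HB.instance Definition _ :=
  GRing.isZmodClosed.Build {freeg (V * W) / K} tensor_ker tensor_ker_zmod.

Definition tensor := {ideal_quot tensor_ker}.
HB.instance Definition _ := Choice.on tensor.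
HB.instance Definition _ := GRing.Zmodule.on tensor.
HB.instance Definition _ := Quotient.on tensor.

Let proj (d : {freeg (V * W) / K}) : tensor := \pi_{ideal_quot tensor_ker} d.

Let projK t : proj (repr t) = t. Proof. exact: reprK. Qed.

Let projB d e : proj (d - e) = proj d - proj e.
Proof. exact: raddfB. Qed.

Let projD d e : proj (d + e) = proj d + proj e.
Proof. exact: raddfD. Qed.

Let proj_eq d e : (proj d = proj e) <-> span bilinear_relation (d - e).
Proof.
split=> [/eqP|/tensor_kerP]; last by rewrite Quotient.idealrBE => /eqP.
by rewrite -Quotient.idealrBE => /tensor_kerP.
Qed.

Definition tscale (a : K) (t : tensor) : tensor :=
  \pi_{ideal_quot tensor_ker} (a *: repr t).

Let tscaleE a d : tscale a (proj d) = proj (a *: d).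
Proof.
apply/proj_eq; rewrite -scalerBr; apply: spanZ; apply/proj_eq; exact: projK.
Qed.

Lemma tscaleA a b t : tscale a (tscale b t) = tscale (a * b) t.
Proof. by rewrite -[t]projK !tscaleE scalerA. Qed.

Lemma tscale1 : left_id 1 tscale.
Proof. by move=> t; rewrite -[t]projK !tscaleE scale1r. Qed.

Lemma tscaleDr : right_distributive tscale +%R.
Proof.
by move=> a t u; rewrite -[t]projK -[u]projK -projD !tscaleE -projD scalerDr.
Qed.

Lemma tscaleDl t : {morph tscale^~ t : a b / a + b}.
Proof. by move=> a b; rewrite -[t]projK !tscaleE -projD scalerDl. Qed.

HB.instance Definition _ :=
  GRing.Zmodule_isLmodule.Build K tensor tscaleA tscale1 tscaleDr tscaleDl.

Definition tens (x : V) (y : W) : tensor := \pi_{ideal_quot tensor_ker} << (x, y) >>.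

Lemma tens_bilinear : bilinear_for *:%R *:%R tens.
Proof.
have projP a d e : proj (a *: d + e) = a *: proj d + proj e.
  by rewrite projD; congr (_ + _); rewrite -tscaleE.
split=> [z a x y|x a y z]; rewrite -[RHS]projP; apply/proj_eq.
  by rewrite opprD addrA; apply/span_gen/RelL.
by rewrite opprD addrA; apply/span_gen/RelR.
Qed.
HB.instance Definition _ :=
  bilinear_isBilinear.Build K V W tensor *:%R *:%R tens tens_bilinear.

Lemma tens_spans t :
  exists s : seq (K * (V * W)), t = \sum_(p <- s) p.1 *: tens p.2.1 p.2.2.
Proof.
exists [seq (coeff b (repr t), b) | b <- dom (repr t)].
rewrite big_map -[LHS]projK -[in LHS](freeg_sumE (repr t)).
rewrite /proj raddf_sum; apply: eq_bigr => -[x y] _ /=.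
rewrite [RHS](tscaleE _ << (x, y) >>) /proj; congr (\pi _).
by apply/eqP/freeg_eqP => b; rewrite coeffZ !coeffU mul1r.
Qed.

Section Lift.
Variables (U : lmodType K) (f : {bilinear V -> W -> U}).

Definition tlift (t : tensor) : U := fglift (fun p => f p.1 p.2) (repr t).

Let tlift_proj d : tlift (proj d) = fglift (fun p => f p.1 p.2) d.
Proof.
apply/eqP; rewrite /tlift -subr_eq0 -linearB.
have /proj_eq[s sR ->] := projK (proj d).
rewrite linear_sum big_seq big1 //= => p /sR Rp; rewrite linearZ /=.
suff -> : fglift (fun p => f p.1 p.2) p.2 = 0 by rewrite scaler0.
by case: Rp => a x y z; rewrite 2!linearB linearZ /= !liftU !scale1r /=
  ?linearPl ?linearPr -addrA -opprD subrr.
Qed.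

Lemma tlift_linear : linear tlift.
Proof.
move=> a t u; rewrite -[t]projK -[u]projK.
by rewrite -[a *: _]/(tscale _ _) tscaleE -projD !tlift_proj linearP.
Qed.
HB.instance Definition _ := GRing.isLinear.Build K tensor U _ tlift tlift_linear.

Lemma tliftE x y : tlift (tens x y) = f x y.
Proof. by rewrite tlift_proj liftU scale1r. Qed.

End Lift.

Lemma tensor_ext (U : lmodType K) (f g : {linear tensor -> U}) :
  (forall x y, f (tens x y) = g (tens x y)) -> f =1 g.
Proof.
move=> fg t; have [s ->] := tens_spans t; rewrite !linear_sum.
by apply: eq_bigr => p _; rewrite !linearZ fg.
Qed.

End Tensor.

Arguments tens {K V W}.

Notation "V ⊗ W" := (tensor V W) (at level 40, left associativity).
Notation "x *t y" := (tens x y) (at level 40, left associativity) : ring_scope.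

Section TensorMaps.
Variable K : fieldType.

Section Map.
Variables (V V' W W' : lmodType K).
Variables (f : {linear V -> V'}) (g : {linear W -> W'}).

Definition tmap_fun (x : V) (y : W) : V' ⊗ W' := f x *t g y.

Lemma tmap_fun_bilinear : bilinear_for *:%R *:%R tmap_fun.
Proof.
by split=> [z a x y|x a y z]; rewrite /tmap_fun linearP ?linearPl ?linearPr.
Qed.
HB.instance Definition _ :=
  bilinear_isBilinear.Build K V W (tensor V' W') *:%R *:%R tmap_fun tmap_fun_bilinear.

Definition tmap : {linear V ⊗ W -> V' ⊗ W'} := tlift tmap_fun.

Lemma tmapE x y : tmap (x *t y) = f x *t g y.
Proof. exact: tliftE. Qed.

End Map.

Section Assoc.
Variables (U V W : lmodType K).

Section Inner.
Variable z : W.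

Definition tassoc_inner (x : U) (y : V) : U ⊗ (V ⊗ W) := x *t (y *t z).

Lemma tassoc_inner_bilinear : bilinear_for *:%R *:%R tassoc_inner.
Proof.
split=> [y a x x'|x a y y']; rewrite /tassoc_inner; first exact: linearPl.
by rewrite linearPl linearPr.
Qed.
HB.instance Definition _ :=
  bilinear_isBilinear.Build K U V (tensor U (tensor V W)) *:%R *:%R tassoc_inner
    tassoc_inner_bilinear.

End Inner.

Definition tassoc_fun (t : U ⊗ V) (z : W) : U ⊗ (V ⊗ W) :=
  tlift (tassoc_inner z) t.

Lemma tassoc_fun_bilinear : bilinear_for *:%R *:%R tassoc_fun.
Proof.
split=> [z|t a z z']; first exact: linearP.
have [s ->] := tens_spans t; rewrite /tassoc_fun.
have E w : tlift (tassoc_inner w) (\sum_(p <- s) p.1 *: (p.2.1 *t p.2.2)) =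
           \sum_(p <- s) p.1 *: (p.2.1 *t (p.2.2 *t w)).
  by rewrite linear_sum; apply: eq_bigr => p _; rewrite linearZ /= tliftE.
rewrite !E /= scaler_sumr -big_split; apply: eq_bigr => p _ /=.
by rewrite !linearPr scalerDr !scalerA mulrC.
Qed.
HB.instance Definition _ :=
  bilinear_isBilinear.Build K (tensor U V) W (tensor U (tensor V W)) *:%R *:%R tassoc_fun
    tassoc_fun_bilinear.

Definition tassoc : {linear (U ⊗ V) ⊗ W -> U ⊗ (V ⊗ W)} := tlift tassoc_fun.

Lemma tassocE x y z : tassoc ((x *t y) *t z) = x *t (y *t z).
Proof.
transitivity (tassoc_fun (x *t y) z); first exact: tliftE.
exact: (tliftE (tassoc_inner z)).
Qed.

End Assoc.

Section Unitors.
Variable V : lmodType K.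

Definition tunitl_fun (a : K^o) (x : V) : V := (a : K) *: x.

Lemma tunitl_fun_bilinear : bilinear_for *:%R *:%R tunitl_fun.
Proof.
split=> [x b a a'|a b x y]; rewrite /tunitl_fun.
  by rewrite scalerDl -scalerA.
by rewrite /= scalerDr !scalerA mulrC.
Qed.
HB.instance Definition _ :=
  bilinear_isBilinear.Build K K^o V V *:%R *:%R tunitl_fun tunitl_fun_bilinear.

Definition tunitl : {linear K^o ⊗ V -> V} := tlift tunitl_fun.

Lemma tunitlE a x : tunitl (a *t x) = (a : K) *: x.
Proof. exact: tliftE. Qed.

Definition tunitr_fun (x : V) (a : K^o) : V := (a : K) *: x.

Lemma tunitr_fun_bilinear : bilinear_for *:%R *:%R tunitr_fun.
Proof.
split=> [a b x y|x b a a'].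
  exact: (tunitl_fun_bilinear.2 a b x y).
exact: (tunitl_fun_bilinear.1 x b a a').
Qed.
HB.instance Definition _ :=
  bilinear_isBilinear.Build K V K^o V *:%R *:%R tunitr_fun tunitr_fun_bilinear.

Definition tunitr : {linear V ⊗ K^o -> V} := tlift tunitr_fun.

Lemma tunitrE x a : tunitr (x *t a) = (a : K) *: x.
Proof. exact: tliftE. Qed.

End Unitors.

Definition tensor_sub (V W : lmodType K) (A : V -> Prop) (B : W -> Prop) :
    V ⊗ W -> Prop :=
  span (fun t => exists x y, [/\ A x, B y & t = x *t y]).

End TensorMaps.

Arguments tassoc {K U V W}.
Arguments tunitl {K V}.
Arguments tunitr {K V}.

Section Coalgebra.
Variables (K : fieldType) (C : lmodType K) (D : {linear C -> C ⊗ C}).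

Definition counital (c : {linear C -> K^o}) : Prop :=
  (forall x, tunitl (tmap c idfun (D x)) = x) /\
  (forall x, tunitr (tmap idfun c (D x)) = x).

Definition cograded (G : nat -> C -> Prop) : Prop :=
  forall n x, G n x ->
    exists t : 'I_n.+1 -> C ⊗ C,
      (forall k : 'I_n.+1, tensor_sub (G k) (G (n - k)%N) (t k)) /\ D x = \sum_k t k.

Definition coassociative : Prop :=
  forall x, tassoc (tmap D idfun (D x)) = tmap idfun D (D x).

End Coalgebra.

(* Range maps are defined on positive integers: [delta 0] is never used. The  *)
(* letter u_i of a word is [nth 0 u i.-1].                                    *)
Section Cliffs.
Variable delta : nat -> nat.

Definition has_valley : Prop :=
  exists i1 i2 i3, [/\ 1 <= i1, i1 < i2, i2 < i3,
    delta i1 > delta i2 & delta i2 < delta i3]%N.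

Definition valley_free : Prop := ~ has_valley.

Definition is_cliff (u : seq nat) : bool :=
  [forall i : 'I_(size u), nth 0 u i <= delta i.+1]%N.

Record cliff := Cliff { cliff_word :> seq nat; _ : is_cliff cliff_word }.
HB.instance Definition _ := [isSub for cliff_word].
HB.instance Definition _ := [Choice of cliff by <:].

Lemma is_cliffP u :
  reflect (forall i, i < size u -> nth 0 u i <= delta i.+1)%N (is_cliff u).
Proof.
apply: (iffP forallP) => [H i ltiu|H i]; first exact: (H (Ordinal ltiu)).
exact: H.
Qed.

Lemma empty_is_cliff : is_cliff [::].
Proof. exact/is_cliffP. Qed.
Definition empty_cliff : cliff := Cliff empty_is_cliff.

Lemma take_is_cliff k (w : cliff) : is_cliff (take k w).
Proof.
case: w => w /= /is_cliffP Hw; apply/is_cliffP => i.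
rewrite size_take_min leq_min => /andP[ltik ltiw].
by rewrite nth_take ?Hw.
Qed.
Definition cliff_take k (w : cliff) : cliff := Cliff (take_is_cliff k w).

Definition reduce_word (v : seq nat) : seq nat :=
  mkseq (fun i => minn (nth 0 v i) (delta i.+1)) (size v).

Lemma reduce_is_cliff v : is_cliff (reduce_word v).
Proof.
apply/is_cliffP => i; rewrite size_mkseq => ltiv.
by rewrite nth_mkseq ?geq_minr.
Qed.
Definition cliff_reduce v : cliff := Cliff (reduce_is_cliff v).

End Cliffs.

Section CliffCoalgebra.
Variables (K : fieldType) (delta : nat -> nat).

Definition Cl : lmodType K := {freeg (cliff delta) / K}.

Definition F (u : cliff delta) : Cl := << u >> : {freeg (cliff delta) / K}.

Definition Cl_degree (n : nat) : Cl -> Prop :=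
  span (fun x => exists u : cliff delta, size u = n /\ x = F u).

(* The factorizations w = u v are indexed by the size k of u. *)
Definition Delta_basis (w : cliff delta) : Cl ⊗ Cl :=
  \sum_(k < (size w).+1) F (cliff_take k w) *t F (cliff_reduce delta (drop k w)).

Definition Delta : {linear Cl -> Cl ⊗ Cl} := fglift Delta_basis.

Lemma DeltaE w : Delta (F w) = Delta_basis w.
Proof. by rewrite -[RHS]scale1r; apply: liftU. Qed.

Definition counit : {linear Cl -> K^o} :=
  fglift (fun u => (u == empty_cliff delta)%:R : K^o).

Lemma counitE u : counit (F u) = (u == empty_cliff delta)%:R.
Proof. by rewrite -[RHS]mul1r; apply: (liftU (M := K^o)). Qed.

End CliffCoalgebra.

(* Main.v *)
Require Import Defs.
From mathcomp Require Import all_boot all_algebra.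
From mathcomp Require Import freeg zify.

Set Implicit Arguments.
Unset Strict Implicit.
Unset Printing Implicit Defensive.

Import GRing.Theory.
Local Open Scope ring_scope.

(** The coalgebra axioms are equalities of linear maps, so they can be checked
on the basis [F w].  Counitality is then the remark that only the extreme
factorizations have an empty factor, together with [reduce_id], and the grading
is respected because taking prefixes and reducing both control sizes.

For coassociativity, both iterated coproducts of [F w] are sums over the
factorizations of [w] in three words, of sizes [j], [l] and the rest.  Since
reduction is letterwise it commutes with taking prefixes, hence the first two
tensor factors are the same on both sides ([DeltaI_Delta], [IDelta_Delta]); only
the third ones differ.  Splitting [w] in two and then its left part leaves the
suffix reduced once, whereas splitting the right part reduces the last word
twice: its letter [i] is cut at [delta (l + i)] by the first reduction and at
[delta i] by the second one.  With letters counted from 1, the two results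
disagree only for some letter x of [w] with
   [delta (l + i) < x <= delta (j + l + i)] and [delta (l + i) < delta i],
and this makes [i], [l + i], [j + l + i] a valley.  Conversely, given a valley
[i1 < i2 < i3], the word [0 ... 0 delta(i3)] of size [i3] has an x of that kind,
and a linear form that sees only the component of sizes [i3 - i2], [i2 - i1],
[i1] and the last letter of the third factor tells the two iterated coproducts
apart ([coassociative_valley_free]). *)

(** Reindexes the pairs of nested prefixes [j <= k] by the sizes of the two
consecutive factors they cut out. *)
Lemma sum_triangle (V : nmodType) (n : nat) (f : nat -> nat -> V) :
  \sum_(0 <= k < n.+1) \sum_(0 <= j < k.+1) f j k =
  \sum_(0 <= j < n.+1) \sum_(0 <= l < (n - j).+1) f j (j + l)%N.
Proof.
transitivity (\sum_(0 <= k < n.+1) \sum_(0 <= j < n.+1 | (j < k.+1)%N) f j k).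
  by apply: eq_big_nat => k /andP[_ kn]; rewrite (big_nat_widen 0 k.+1 n.+1).
rewrite (exchange_big_dep_nat xpredT) //=; apply: eq_big_nat => j /andP[_ jn].
rewrite -(big_nat_widenl j 0 n.+1 xpredT) // -[X in \sum_(X <= _ < _) _]add0n big_addn subSn //.
by apply: eq_bigr => l _; rewrite addnC.
Qed.

(** Among the factorizations in three words, the sizes of the first two
determine the factorization. *)
Lemma sum_select (R : pzRingType) (n j0 l0 : nat) (c : nat -> nat -> R) :
  (j0 + l0 <= n)%N ->
  \sum_(0 <= j < n.+1) \sum_(0 <= l < (n - j).+1)
     (j == j0)%:R * ((l == l0)%:R * c j l) = c j0 l0.
Proof.
move=> le_n.
under eq_bigr => j _ do rewrite -mulr_sumr mulr_natl mulrb.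
rewrite -big_mkcond big_nat1_eq ifT; last by lia.
under eq_bigr => l _ do rewrite mulr_natl mulrb.
by rewrite -big_mkcond big_nat1_eq ifT //; lia.
Qed.

Section Words.
Variable delta : nat -> nat.
Implicit Types (u v : seq nat) (w : cliff delta).

Lemma size_reduce v : size (reduce_word delta v) = size v.
Proof. exact: size_mkseq. Qed.

Lemma nth_reduce v i :
  nth 0%N (reduce_word delta v) i = minn (nth 0%N v i) (delta i.+1).
Proof.
have [lt_iv|le_vi] := ltnP i (size v); first by rewrite nth_mkseq.
by rewrite !nth_default ?size_reduce // min0n.
Qed.

Lemma cliff_le w i : (i < size w)%N -> (nth 0%N w i <= delta i.+1)%N.
Proof. by case: w => u cu; move/is_cliffP: (cu); apply. Qed.

Lemma reduce_take l v : reduce_word delta (take l v) = take l (reduce_word delta v).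
Proof.
apply: (@eq_from_nth _ 0%N) => [|i].
  by rewrite size_reduce !size_take_min size_reduce.
rewrite size_reduce size_take_min leq_min => /andP[lt_il _].
by rewrite nth_reduce !nth_take // nth_reduce.
Qed.

Lemma reduce_id w : cliff_reduce delta w = w.
Proof.
apply: val_inj; apply: (@eq_from_nth _ 0%N) => [|i]; rewrite /= size_reduce // => ltiw.
by rewrite nth_reduce; apply/minn_idPl/cliff_le.
Qed.

Lemma take_full w : cliff_take (size w) w = w.
Proof. by apply: val_inj; rewrite /= take_size. Qed.

(** The combinatorial heart of the theorem: the inner reduction can be omitted
unless it cuts a letter below the bound imposed by the outer one, which takes a
valley.  The bounds at positions [l + i] and [j + l + i] must be at distinct
positions for this, hence the separate cases [j = 0] and [l = 0]. *)
Lemma reduce_drop_reduce w j l : valley_free delta ->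
  cliff_reduce delta (drop l (cliff_reduce delta (drop j w))) =
  cliff_reduce delta (drop (j + l) w).
Proof.
move=> noval; apply: val_inj; apply: (@eq_from_nth _ 0%N) => [|i] /=.
  by rewrite !size_reduce !size_drop size_reduce size_drop; lia.
rewrite !size_reduce size_drop size_reduce size_drop => lti.
rewrite !nth_reduce !nth_drop nth_reduce nth_drop addnA.
have /cliff_le : (j + l + i < size w)%N by lia.
have [j0|j_gt0] := posnP j; first by rewrite j0 !add0n; lia.
have [l0|l_gt0] := posnP l; first by rewrite l0 !add0n; lia.
set x := nth _ _ _ => le_x.
have [//|ltlx] := leqP x (delta (l + i).+1).
have [lt_li|] := ltnP (delta (l + i).+1) (delta i.+1); last by lia.
by case: noval; exists i.+1, (l + i).+1, (j + l + i).+1; split; lia.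
Qed.

End Words.

Section Coalgebra.
Variables (K : fieldType) (delta : nat -> nat).
Local Notation C := (Cl K delta).
Local Notation F := (F K).
Implicit Types w : cliff delta.

Lemma Cl_ext (U : lmodType K) (f g : {linear C -> U}) :
  (forall u, f (F u) = g (F u)) -> f =1 g.
Proof.
move=> fg x; have -> : x = \sum_(b <- dom x) coeff b x *: F b.
  rewrite -[LHS]freeg_sumE; apply: eq_bigr => b _.
  by apply/eqP/freeg_eqP => c; rewrite coeffZ !coeffU mul1r.
by rewrite !linear_sum; apply: eq_bigr => b _; rewrite !linearZ /= fg.
Qed.

Lemma Delta_F w :
  Delta K delta (F w) =
  \sum_(0 <= k < (size w).+1) F (cliff_take k w) *t F (cliff_reduce delta (drop k w)).
Proof. by rewrite DeltaE big_mkord. Qed.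

Definition charfun (P : pred (cliff delta)) : {linear C -> K^o} :=
  fglift (fun u => (P u)%:R : K^o).

Lemma charfunE P u : charfun P (F u) = (P u)%:R.
Proof. by rewrite -[RHS]mul1r; apply: (liftU (M := K^o)). Qed.

Lemma Delta_counital : counital (Delta K delta) (counit K delta).
Proof.
split=> x.
- apply: (Cl_ext (f := tunitl \o tmap (counit K delta) idfun \o Delta K delta)
                 (g := idfun)) => w /=.
  rewrite Delta_F !linear_sum big_nat_recl //= big_nat big1 ?addr0.
    rewrite tmapE tunitlE counitE drop0 reduce_id.
    by rewrite (_ : cliff_take 0 w = empty_cliff _) ?eqxx ?scale1r //; apply/val_inj/take0.
  move=> i /andP[_ lti]; rewrite tmapE tunitlE counitE -val_eqE /= -size_eq0.
  by rewrite size_takel //= scale0r.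
- apply: (Cl_ext (f := tunitr \o tmap idfun (counit K delta) \o Delta K delta)
                 (g := idfun)) => w /=.
  rewrite Delta_F !linear_sum big_nat_recr //= big_nat big1 ?add0r.
    rewrite tmapE tunitrE counitE drop_size take_full.
    by rewrite (_ : cliff_reduce _ _ = empty_cliff _) ?eqxx ?scale1r //; apply/val_inj.
  move=> i /andP[_ lti]; rewrite tmapE tunitrE counitE -val_eqE /= -size_eq0.
  by rewrite size_reduce size_drop (_ : _ == _ = false) ?scale0r //; lia.
Qed.

Lemma Delta_cograded : cograded (Delta K delta) (@Cl_degree K delta).
Proof.
move=> n _ [s sS ->]; elim: s sS => [|[a y] s IHs] sS.
  exists (fun=> 0); split=> [k|]; first exact: span0.
  by rewrite big_nil linear0 big1.
have [|t [tG Dt]] := IHs; first by move=> p ps; apply: sS; rewrite inE ps orbT.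
have [w [szw /= ->]] := sS _ (mem_head _ _).
exists (fun k : 'I_n.+1 => a *: (F (cliff_take k w) *t F (cliff_reduce delta (drop k w))) + t k).
split=> [k|].
  apply: spanD (tG k); apply/spanZ/span_gen; do 2!eexists; split; last by [].
    apply: span_gen; eexists; split; last by [].
    by rewrite /= size_take_min szw; have := ltn_ord k; lia.
  apply: span_gen; eexists; split; last by [].
  by rewrite /= size_reduce size_drop szw.
by rewrite big_cons linearD linearZ Dt /= Delta_F szw big_mkord big_split scaler_sumr.
Qed.

(** The sum is stated over the sizes [j] and [l] of the first two factors, and
the second factor is written as a prefix of a reduced suffix, so that it can be
compared term by term with [IDelta_Delta]. *)
Lemma DeltaI_Delta w :
  tassoc (tmap (Delta K delta) idfun (Delta K delta (F w))) =
  \sum_(0 <= j < (size w).+1) \sum_(0 <= l < (size w - j).+1)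
    F (cliff_take j w) *t
      (F (cliff_take l (cliff_reduce delta (drop j w))) *t
       F (cliff_reduce delta (drop (j + l) w))).
Proof.
rewrite Delta_F !linear_sum /=.
transitivity (\sum_(0 <= k < (size w).+1) \sum_(0 <= j < k.+1)
    F (cliff_take j w) *t
      (F (cliff_take (k - j) (cliff_reduce delta (drop j w))) *t
       F (cliff_reduce delta (drop k w)))).
  apply: eq_big_nat => k /andP[_ lek]; rewrite tmapE Delta_F /=.
  rewrite size_takel // linear_sumlz linear_sum.
  apply: eq_big_nat => j /andP[_ lej]; rewrite /= tassocE.
  congr (F _ *t (F _ *t _)); apply: val_inj => /=; first by rewrite take_takel.
  by rewrite -reduce_take take_drop subnK.
rewrite sum_triangle; apply: eq_bigr => j _; apply: eq_bigr => l _.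
by rewrite addKn.
Qed.

Lemma IDelta_Delta w :
  tmap idfun (Delta K delta) (Delta K delta (F w)) =
  \sum_(0 <= j < (size w).+1) \sum_(0 <= l < (size w - j).+1)
    F (cliff_take j w) *t
      (F (cliff_take l (cliff_reduce delta (drop j w))) *t
       F (cliff_reduce delta (drop l (cliff_reduce delta (drop j w))))).
Proof.
rewrite Delta_F !linear_sum /=; apply: eq_bigr => j _.
by rewrite tmapE Delta_F /= size_reduce size_drop linear_sumr.
Qed.

Lemma valley_free_coassociative :
  valley_free delta -> coassociative (Delta K delta).
Proof.
move=> noval x.
apply: (Cl_ext (f := tassoc \o tmap (Delta K delta) idfun \o Delta K delta)
               (g := tmap idfun (Delta K delta) \o Delta K delta)) => w /=.
rewrite DeltaI_Delta IDelta_Delta; apply: eq_bigr => j _; apply: eq_bigr => l _.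
by rewrite reduce_drop_reduce.
Qed.

(** A linear form standing for the linear independence of the tensors of basis
elements: sizes are enough to isolate one factorization, so that no dual basis
of the triple tensor product is required. *)
Definition probe (j l : nat) (P : pred (cliff delta)) : {linear C ⊗ (C ⊗ C) -> K^o} :=
  tunitl \o tmap (charfun (fun u => size u == j))
              (tunitl \o tmap (charfun (fun u => size u == l)) (charfun P)).

Lemma probe_sum w j l P (third : nat -> nat -> cliff delta) :
  (j + l <= size w)%N ->
  probe j l P (\sum_(0 <= j' < (size w).+1) \sum_(0 <= l' < (size w - j').+1)
    F (cliff_take j' w) *t
      (F (cliff_take l' (cliff_reduce delta (drop j' w))) *t F (third j' l'))) =
  (P (third j l))%:R.
Proof.
move=> le_w; rewrite linear_sum.
rewrite -[RHS](sum_select (fun j' l' => (P (third j' l'))%:R) le_w).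
apply: eq_big_nat => j' lej'; rewrite linear_sum; apply: eq_big_nat => l' lel'.
rewrite /= !(tmapE, tunitlE) /= !(tmapE, tunitlE) !charfunE /=.
by rewrite !size_takel // size_reduce size_drop.
Qed.

(** The letter at the last position of a valley is as large as possible, so
that it exceeds the bound at the bottom of the valley; the value of the other
letters is immaterial, and 0 is always allowed. *)
Definition spike_word n : seq nat := rcons (nseq n 0%N) (delta n.+1).

Lemma spike_is_cliff n : is_cliff delta (spike_word n).
Proof.
apply/is_cliffP => i; rewrite size_rcons nth_rcons size_nseq nth_nseq if_same.
by case: (ltngtP i n) => // ->.
Qed.

Lemma coassociative_valley_free :
  coassociative (Delta K delta) -> valley_free delta.
Proof.
move=> coassoc [j1 [j2 [j3 []]]].
case: j1 j2 j3 => [|i1] [|i2] [|i3] // _ lt12 lt23 gt_12 lt_23.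
pose w := Cliff (spike_is_cliff i3).
have szw : size w = i3.+1 by rewrite /= size_rcons size_nseq.
have w_i3 : nth 0%N w i3 = delta i3.+1 by rewrite nth_rcons size_nseq ltnn eqxx.
(* The third factor has size [i1.+1]; its last letter is the one coming from the
   spike, and [delta i2.+1] is what the double reduction makes of it. *)
pose P (z : cliff delta) := nth 0%N z i1 == delta i2.+1.
have := congr1 (probe (i3 - i2) (i2 - i1) P) (coassoc (F w)).
rewrite DeltaI_Delta IDelta_Delta.
rewrite (probe_sum _ (fun j l => cliff_reduce delta (drop (j + l) w))); last by lia.
rewrite (probe_sum _ (fun j l =>
  cliff_reduce delta (drop l (cliff_reduce delta (drop j w))))); last by lia.
rewrite /P [cliff_word _]/= nth_reduce nth_drop.
rewrite [cliff_word _ in RHS]/= nth_reduce nth_drop nth_reduce nth_drop.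
have -> : (i3 - i2 + (i2 - i1) + i1 = i3)%N by lia.
have -> : (i2 - i1 + i1 = i2)%N by lia.
have -> : (i3 - i2 + i2 = i3)%N by lia.
rewrite -/(cliff_word w) w_i3.
have -> : minn (delta i3.+1) (delta i1.+1) == delta i2.+1 = false by lia.
have -> : minn (minn (delta i3.+1) (delta i2.+1)) (delta i1.+1) == delta i2.+1 by lia.
by move/eqP; rewrite eq_sym oner_eq0.
Qed.

End Coalgebra.

Theorem theorem3p1p1 (K : fieldType) (charK0 : [pchar K] =i pred0)
    (delta : nat -> nat) :
  [/\ counital (Delta K delta) (counit K delta),
      cograded (Delta K delta) (@Cl_degree K delta)
    & coassociative (Delta K delta) <-> valley_free delta].
Proof.
split; [exact: Delta_counital | exact: Delta_cograded |].
by split; [exact: coassociative_valley_free | exact: valley_free_coassociative].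
Qed.
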